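(* Let $k\geq 2$, let $M_k=[z^k-w^k]\subset H^2(\mathbb D^2)$, and let $C$ be its core operator on $H^2(\mathbb D^2)$. The eigenvalues of $C$ are $$\{0,1\}\cup\left\{\pm\frac{1}{m+1}: m\geq 1\right\},$$ where $0$ has infinite multiplicity, $1$ has multiplicity one, and each of $\pm\frac{1}{m+1}$ ($m\ge1$) has multiplicity one.
   Context: $H^2(\mathbb D^2)$ is the Hardy space of the bidisk with coordinates $(z,w)$. For a polynomial $p$, $[p]$ denotes the closure of $p\,\mathbb C[z,w]$ in $H^2(\mathbb D^2)$; it is a submodule, i.e. a closed subspace invariant under multiplication by $z$ and $w$. For a submodule $M$, let $K^M(\lambda,\cdot)$ be the reproducing kernel of $M$ at $\lambda=(\lambda_1,\lambda_2)$ and $G^M(\lambda,(z,w))=(1-\overline{\lambda_1}z)(1-\overline{\lambda_2}w)K^M(\lambda,(z,w))$. The core operator of $M$ is the operator $C=C^M$ on $H^2(\mathbb D^2)$ given by $C^Mf(z,w)=\int_{\mathbb T^2}G^M(\lambda,(z,w))f(\lambda)\,dm(\lambda)$, with $m$ normalized Lebesgue measure on $\mathbb T^2$. Equivalently, $C^M$ is $0$ on $M^\perp$ and equals $I-R_1R_1^*-R_2R_2^*+R_1R_2R_1^*R_2^*$ on $M$, where $R_1,R_2$ are the restrictions to $M$ of multiplication by $z$ and $w$, respectively. *)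

(* Defs.v *)
From HB Require Import structures.
From mathcomp Require Import all_boot all_order all_algebra.
From mathcomp Require Import all_classical all_reals all_analysis.
From mathcomp Require Import complex.

Set Implicit Arguments.
Unset Strict Implicit.
Unset Printing Implicit Defensive.

Import Order.TTheory GRing.Theory Num.Theory.
Import numFieldNormedType.Exports.

Local Open Scope classical_set_scope.
Local Open Scope ring_scope.
Local Open Scope complex_scope.

(* An element f(z,w) = \sum_(i,j) a_(i,j) z^i w^j of H^2(D^2) is represented by
   its array of Taylor coefficients (i, j) |-> a_(i,j); H^2(D^2) is the space of
   the square-summable arrays. The operators below are functions on all arrays,
   only meant to be used on [hardy2]. *)
Definition coefs (R : realType) := nat * nat -> R[i].

Definition hardy2 (R : realType) : set (coefs R) :=
  [set f | (\esum_(ij in [set: nat * nat])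
             ((ComplexField.Normc.normc (f ij)) ^+ 2)%:E < +oo)%E].

Definition hdot_partial (R : realType) (f g : coefs R) (n : nat) : R[i] :=
  \sum_(i < n) \sum_(j < n) f (i : nat, j : nat) * (g (i : nat, j : nat))^*.

(* For f, g in H^2 the double series defining <f, g> converges absolutely, so
   it may be summed along squares; real and imaginary parts are summed
   separately to only use limits in R. *)
Definition hdot (R : realType) (f g : coefs R) : R[i] :=
  limn (fun n => complex.Re (hdot_partial f g n)) +i*
  limn (fun n => complex.Im (hdot_partial f g n)).

Definition hnorm (R : realType) (f : coefs R) : R :=
  Num.sqrt (complex.Re (hdot f f)).

Definition mulz (R : realType) (f : coefs R) : coefs R :=
  fun ij => if ij.1 is i.+1 then f (i, ij.2) else 0.

Definition mulw (R : realType) (f : coefs R) : coefs R :=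
  fun ij => if ij.2 is j.+1 then f (ij.1, j) else 0.

(* C[z,w] is {poly {poly R[i]}}: z is the outer variable 'X and w is the inner
   variable, i.e. the constant 'X%:P. *)
Definition coefs_of_poly (R : realType) (p : {poly {poly R[i]}}) : coefs R :=
  fun ij => p`_ij.1`_ij.2.

Definition poly_submodule (R : realType) (p : {poly {poly R[i]}}) :
    set (coefs R) :=
  [set f | hardy2 f /\ forall e : R, 0 < e ->
     exists q : {poly {poly R[i]}},
       hnorm (fun ij => f ij - coefs_of_poly (p * q) ij) < e].

(* [xget 0 P] is an element of P if there is one; when M is a closed subspace
   of H^2, the elements described by the next two definitions exist and are
   unique, for f in H^2 and f in M respectively. *)
Definition hproj (R : realType) (M : set (coefs R)) (f : coefs R) : coefs R :=
  xget (fun=> 0) [set g | M g /\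
    forall h, M h -> hdot (fun ij => f ij - g ij) h = 0].

(* The adjoint of the restriction T|M : M -> M. *)
Definition restr_adj (R : realType) (M : set (coefs R))
    (T : coefs R -> coefs R) (f : coefs R) : coefs R :=
  xget (fun=> 0) [set g | M g /\ forall h, M h -> hdot (T h) f = hdot h g].

(* I - R1 R1^* - R2 R2^* + R1 R2 R1^* R2^* on M, and 0 on the orthogonal
   complement of M. *)
Definition core_operator (R : realType) (M : set (coefs R)) (f : coefs R) :
    coefs R :=
  let g := hproj M f in
  let R1s := restr_adj M (@mulz R) in
  let R2s := restr_adj M (@mulw R) in
  fun ij => g ij - mulz (R1s g) ij - mulw (R2s g) ij
            + mulz (mulw (R1s (R2s g))) ij.

Definition eigenspace_of (R : realType) (T : coefs R -> coefs R) (l : R[i]) :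
    set (coefs R) :=
  [set f | hardy2 f /\ forall ij, T f ij = l * f ij].

Definition is_eigenvalue (R : realType) (T : coefs R -> coefs R) (l : R[i]) :=
  exists2 f, eigenspace_of T l f & exists ij, f ij != 0.

Definition lin_indep (R : realType) (n : nat) (v : 'I_n -> coefs R) :=
  forall c : 'I_n -> R[i],
    (forall ij, \sum_(s < n) c s * v s ij = 0) -> forall s, c s = 0.

Definition multiplicity_ge (R : realType) (T : coefs R -> coefs R) (l : R[i])
    (n : nat) :=
  exists2 v : 'I_n -> coefs R,
    forall s, eigenspace_of T l (v s) & lin_indep v.

Definition has_multiplicity (R : realType) (T : coefs R -> coefs R) (l : R[i])
    (n : nat) :=
  multiplicity_ge T l n /\ ~ multiplicity_ge T l n.+1.

Definition infinite_multiplicity (R : realType) (T : coefs R -> coefs R)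
    (l : R[i]) :=
  forall n, multiplicity_ge T l n.

(* Main.v *)
Require Import Defs.
From mathcomp Require Import all_boot all_order all_algebra.
From mathcomp Require Import all_classical all_reals all_analysis.
From mathcomp Require Import complex.
From mathcomp Require Import ring lra zify.

(* M = [z^k - w^k] consists of the f in H^2 whose coefficients have zero sum over
   every class {(i, j) : i + j = d, i = r mod k}, so the projection P onto M
   subtracts the class averages. The adjoints of R1, R2 are P z^*, P w^* (backward
   shifts), and shifting an index changes class sums and class sizes only through
   the end points (0, d), (d, 0) when k | i or k | j. Hence C f vanishes off the
   indices (k a, k b), and in degree k N it is a small explicit operator depending
   on f(0, k N), f(k N, 0) and the class sum. On an eigenvector with eigenvalue
   l != 0 the class sum vanishes and p = f(0, k N), q = f(k N, 0) satisfy
   l p = - q / N, l q = - p / N and determine f in that degree, so (l N)^2 = 1. *)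

Set Implicit Arguments.
Unset Strict Implicit.
Unset Printing Implicit Defensive.

Import Order.TTheory GRing.Theory Num.Theory.
Import numFieldNormedType.Exports.

Local Open Scope classical_set_scope.
Local Open Scope ring_scope.

(** * Sums by total degree *)

(** The inner product is a limit along squares, while everything that matters here respects the
    total degree: a class lies in one degree, the projection acts on each degree separately, and a
    shift moves every degree by one. Square-summability and inner products are therefore transferred
    to partial sums by degree. There, self-adjointness of the projection and adjointness of the
    shifts are exact identities between finite sums, and limits are taken only afterwards. [hproj]
    and [restr_adj] choose an element by [xget], so evaluating them requires uniqueness, which comes
    from testing against projected monomials. The class sum of an eigenvector vanishes because C
    maps into M; in coordinates this is seen by adding the eigenvalue equations over a class. Degree
    k is special: it has no inner index, so a zero class sum gives q = - p, and l p = - q leaves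
    only l = 1. This is why -1 is absent while both signs occur for N >= 2. *)

Definition dsum (V : nmodType) (u : nat * nat -> V) (n : nat) : V :=
  \sum_(d < n) \sum_(i < d.+1) u (i : nat, (d - i)%N).

Definition square_sum (V : nmodType) (u : nat * nat -> V) (n : nat) : V :=
  \sum_(i < n) \sum_(j < n) u (i : nat, j : nat).

Lemma eq_dsum (V : nmodType) (u v : nat * nat -> V) n :
  (forall p, (p.1 + p.2 < n)%N -> u p = v p) -> dsum u n = dsum v n.
Proof.
move=> uv; apply: eq_bigr => d _; apply: eq_bigr => i _; apply: uv => /=.
by rewrite subnKC // -ltnS.
Qed.

Lemma dsumD (V : nmodType) (u v : nat * nat -> V) n :
  dsum (fun p => u p + v p) n = dsum u n + dsum v n.
Proof.
rewrite /dsum -big_split /=; apply: eq_bigr => d _; exact: big_split.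
Qed.

Lemma dsum_morph (V W : nmodType) (phi : V -> W) (u : nat * nat -> V) n :
  phi 0 = 0 -> {morph phi : x y / x + y} ->
  phi (dsum u n) = dsum (phi \o u) n.
Proof.
move=> phi0 phiD; rewrite /dsum (big_morph phi phiD phi0).
by apply: eq_bigr => d _; rewrite (big_morph phi phiD phi0).
Qed.

Lemma square_sum_morph (V W : nmodType) (phi : V -> W) (u : nat * nat -> V) n :
  phi 0 = 0 -> {morph phi : x y / x + y} ->
  phi (square_sum u n) = square_sum (phi \o u) n.
Proof.
move=> phi0 phiD; rewrite /square_sum (big_morph phi phiD phi0).
by apply: eq_bigr => d _; rewrite (big_morph phi phiD phi0).
Qed.

Lemma dsumB (V : zmodType) (u v : nat * nat -> V) n :
  dsum (fun p => u p - v p) n = dsum u n - dsum v n.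
Proof.
rewrite dsumD; congr (_ + _).
by rewrite (@dsum_morph _ _ -%R v) ?oppr0 //; apply: opprD.
Qed.

Lemma dsum0 (V : nmodType) (u : nat * nat -> V) n :
  (forall p, u p = 0) -> dsum u n = 0.
Proof. by move=> u0; rewrite /dsum big1 // => d _; rewrite big1. Qed.

Lemma dsum_shiftz (V : nmodType) (u : nat * nat -> V) n :
  dsum u n.+1 = \sum_(j < n.+1) u (0%N, j : nat)
                + dsum (fun p => u (p.1.+1, p.2)) n.
Proof.
rewrite /dsum; under eq_bigr do rewrite big_ord_recl subn0 /=.
rewrite big_split /=; congr (_ + _).
rewrite big_ord_recl big_ord0 add0r.
by apply: eq_bigr => d _; apply: (@eq_bigr _ _ _ 'I_d.+1).
Qed.

Lemma dsum_shiftw (V : nmodType) (u : nat * nat -> V) n :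
  dsum u n.+1 = \sum_(i < n.+1) u (i : nat, 0%N)
                + dsum (fun p => u (p.1, p.2.+1)) n.
Proof.
rewrite /dsum; under eq_bigr do rewrite big_ord_recr subnn /=.
rewrite big_split /= addrC; congr (_ + _).
rewrite big_ord_recl big_ord0 add0r; apply: eq_bigr => d _ /=.
by apply: (@eq_bigr _ _ _ 'I_d.+1) => i _; rewrite -subSn // -ltnS.
Qed.

Lemma dsum_triangle (V : nmodType) (u : nat * nat -> V) n :
  dsum u n = \sum_(i < n) \sum_(j < n - i) u (i : nat, j : nat).
Proof.
elim: n => [|n IHn]; first by rewrite /dsum !big_ord0.
rewrite /dsum big_ord_recr /= -/(dsum u n) IHn.
transitivity (\sum_(i < n.+1) (\sum_(j < n - i) u (i : nat, j : nat)
                               + u (i : nat, (n - i)%N))).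
  by rewrite big_split /= [X in _ = X + _]big_ord_recr /= subnn big_ord0 addr0.
by apply: eq_bigr => i _; rewrite subSn ?leq_ord // big_ord_recr.
Qed.

(** The square of side n lies in the triangle of degrees below n + n, so a square sum is a degree
    sum of a truncated array. *)
Lemma square_sum_dsum (V : nmodType) (u : nat * nat -> V) n :
  square_sum u n =
  dsum (fun p => if (p.1 < n)%N && (p.2 < n)%N then u p else 0) (n + n).
Proof.
rewrite dsum_triangle big_split_ord /= [X in _ = _ + X]big1 ?addr0; last first.
  by move=> i _; rewrite big1 // => j _; rewrite ltnNge leq_addr.
apply: eq_bigr => i _; rewrite -addnBA ?(ltnW (ltn_ord i)) //.
rewrite big_split_ord /= [X in _ = _ + X]big1 ?addr0; last first.
  by move=> j _; rewrite [(n + _ < n)%N]ltnNge leq_addr andbF.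
by apply: eq_bigr => j _; rewrite !ltn_ord.
Qed.

Lemma ler_dsum (R : numDomainType) (u v : nat * nat -> R) n :
  (forall p, u p <= v p) -> dsum u n <= dsum v n.
Proof. by move=> uv; apply: ler_sum => d _; apply: ler_sum. Qed.

Lemma ler_norm_dsum (R : numDomainType) (u v : nat * nat -> R) m n :
  (forall p, `|u p| <= v p) ->
  (forall p, (p.1 + p.2 < m)%N -> u p = 0) -> (m <= n)%N ->
  `|dsum u n| <= dsum v n - dsum v m.
Proof.
move=> uv u0 mn; rewrite -(subnKC mn) /dsum !big_split_ord /=.
rewrite [leRHS]addrAC subrr add0r [X in X + _]big1 ?add0r.
  apply: le_trans (ler_norm_sum _ _ _) _; apply: ler_sum => d _.
  by apply: le_trans (ler_norm_sum _ _ _) _; apply: ler_sum.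
move=> d _; apply: big1 => i _; apply: u0 => /=.
by rewrite subnKC // -ltnS.
Qed.

Lemma dsum_homo (R : numDomainType) (u : nat * nat -> R) :
  (forall p, 0 <= u p) -> {homo dsum u : m n / (m <= n)%N >-> m <= n}.
Proof.
move=> u0 m n mn; rewrite -subr_ge0.
apply: le_trans (normr_ge0 _) (ler_norm_dsum (u := fun=> 0) _ _ mn) => // p.
by rewrite normr0.
Qed.

Lemma ler_dsum_term (R : numDomainType) (u : nat * nat -> R) p :
  (forall p, 0 <= u p) -> u p <= dsum u (p.1 + p.2).+1.
Proof.
move=> u0; rewrite /dsum big_ord_recr /= -[leLHS]add0r lerD //.
  by apply: sumr_ge0 => d _; apply: sumr_ge0.
have lt1 : (p.1 < (p.1 + p.2).+1)%N by rewrite ltnS leq_addr.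
rewrite (bigD1 (Ordinal lt1)) //= addKn -surjective_pairing.
by rewrite lerDl sumr_ge0.
Qed.

(** The square of side n contains the triangle of degrees below n and lies in that of degrees below
    2n. The two partial sums of u thus differ by at most the increment of the sums of v from n to
    2n, which tends to 0. *)
Lemma dsum_cvg (R : realType) (u v : nat * nat -> R) (B : R) :
  (forall p, `|u p| <= v p) -> (forall n, dsum v n <= B) ->
  exists a : R, dsum u @ \oo --> a /\ square_sum u @ \oo --> a.
Proof.
move=> uv vB.
have v0 p : 0 <= v p by apply: le_trans (uv p).
have dsumE (w : nat * nat -> R) :
    dsum w = series (fun d => \sum_(i < d.+1) w (i : nat, (d - i)%N)).
  by apply/funext => n; rewrite /series /= big_mkord.
have cv : cvgn (dsum v).
  apply: nondecreasing_is_cvgn; first exact: dsum_homo.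
  by exists B => _ [n _ <-].
have cu : cvgn (dsum u).
  rewrite dsumE; apply: normed_cvg; rewrite dsumE in cv.
  apply: series_le_cvg cv => [d|d|d]; rewrite ?normr_ge0 ?sumr_ge0 //.
  by apply: le_trans (ler_norm_sum _ _ _) _; apply: ler_sum.
exists (limn (dsum u)); split; first exact: cu.
apply: cvg_sub0 (cu); apply: norm_cvg0.
have dbl : (fun n => (n + n)%N) @ \oo --> \oo.
  apply/cvgnyPge => A; near=> n; apply: leq_trans (leq_addr n n).
  by near: n; exact: nbhs_infty_ge.
have cv2 : dsum v (n + n)%N - dsum v n @[n --> \oo] --> 0.
  rewrite -(subrr (limn (dsum v))); apply: cvgB; last exact: cv.
  exact: cvg_comp dbl cv.
apply: (@squeeze_cvgr _ _ _ _ (fun=> 0) _ _ _ 0 _ cv2); last exact: cvg_cst.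
near=> n.
rewrite normr_ge0 [X in `|X|](_ : _ = square_sum u n - dsum u n) //= square_sum_dsum.
set r := fun p => _.
have -> : dsum u n = dsum (fun p => if (p.1 + p.2 < n)%N then u p else 0) (n + n).
  rewrite {2}/dsum big_split_ord /= [X in _ = _ + X]big1 ?addr0.
    apply: eq_bigr => d _; apply: eq_bigr => i _.
    by rewrite /= subnKC ?leq_ord // ltn_ord.
  by move=> d _; apply: big1 => i _; rewrite subnKC ?leq_ord // ltnNge leq_addr.
rewrite -[X in `|X|]dsumB; apply: ler_norm_dsum; last exact: leq_addr.
  move=> p; rewrite /r; do !case: ifP => //= _;
    by rewrite ?subrr ?subr0 ?sub0r ?normrN ?normr0.
move=> p pn; rewrite /r pn (leq_ltn_trans (leq_addr _ _) pn).
by rewrite (leq_ltn_trans (leq_addl _ _) pn) subrr.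
Unshelve. all: by end_near.
Qed.

(** * Square-summable arrays and the inner product *)

Notation Re := complex.Re.
Notation Im := complex.Im.
Notation normc := ComplexField.Normc.normc.

Lemma ReD (R : realType) : {morph (@Re R) : x y / x + y}.
Proof. by case=> a b [c d]. Qed.

Lemma ImD (R : realType) : {morph (@Im R) : x y / x + y}.
Proof. by case=> a b [c d]. Qed.

Lemma complex_eqP (R : realType) (x y : R[i]) : Re x = Re y -> Im x = Im y -> x = y.
Proof. by case: x y => [a b] [c d] /= -> ->. Qed.

Definition nsq (R : realType) (f : coefs R) (p : nat * nat) : R :=
  normc (f p) ^+ 2.

Definition cprod (R : realType) (f g : coefs R) (p : nat * nat) : R[i] :=
  f p * (g p)^*.

Lemma nsqE (R : realType) (f : coefs R) p :
  nsq f p = Re (f p) ^+ 2 + Im (f p) ^+ 2.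
Proof.
by rewrite /nsq; case: (f p) => a b /=; rewrite sqr_sqrtr // addr_ge0 ?sqr_ge0.
Qed.

Lemma nsq_ge0 (R : realType) (f : coefs R) p : 0 <= nsq f p.
Proof. exact: sqr_ge0. Qed.

Lemma Re_cprod (R : realType) (f g : coefs R) p :
  Re (cprod f g p) = Re (f p) * Re (g p) + Im (f p) * Im (g p).
Proof.
by rewrite /cprod; case: (f p) => a b; case: (g p) => c d /=; rewrite mulrN opprK.
Qed.

Lemma Im_cprod (R : realType) (f g : coefs R) p :
  Im (cprod f g p) = Im (f p) * Re (g p) - Re (f p) * Im (g p).
Proof.
by rewrite /cprod; case: (f p) => a b; case: (g p) => c d /=; rewrite mulrN addrC.
Qed.

Lemma Re_cprod_diag (R : realType) (f : coefs R) p : Re (cprod f f p) = nsq f p.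
Proof. by rewrite Re_cprod nsqE !expr2. Qed.

Lemma esum_dsum (R : realType) (u : nat * nat -> R) : (forall p, 0 <= u p) ->
  (\esum_(p in [set: nat * nat]) (u p)%:E =
   \sum_(d <oo) (\sum_(i < d.+1) u (i : nat, (d - i)%N))%:E)%E.
Proof.
move=> u0.
have -> : [set: nat * nat] = \bigcup_d [set p : nat * nat | (p.1 + p.2)%N = d].
  by apply/seteqP; split => // p _; exists (p.1 + p.2)%N.
rewrite nneseries_sum_bigcup; last 2 first.
- by move=> d e _ _ [p [/= <- <-]].
- by move=> p; rewrite lee_fin.
apply: eq_eseriesr => d _.
rewrite (@reindex_esum _ _ _ `I_d.+1 _ (fun i => (i, (d - i)%N))); last first.
  split.
  - by move=> i /= id; rewrite subnKC.
  - by move=> i j _ _ [].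
  - move=> [i j] /= <-; exists i; last by rewrite addKn.
    by rewrite /= ltnS leq_addr.
rewrite esum_fset //; last by move=> i _; rewrite lee_fin.
by rewrite -sumEFin -(fsbig_ord _ _ (fun i => (u (i, (d - i)%N))%:E)).
Qed.

Lemma hardy2P (R : realType) (f : coefs R) :
  hardy2 f <-> exists B, forall n, dsum (nsq f) n <= B.
Proof.
have t0 d : (0 <= (\sum_(i < d.+1) nsq f (i : nat, (d - i)%N))%:E)%E.
  by rewrite lee_fin sumr_ge0 // => i _; exact: nsq_ge0.
have partE n : (\sum_(0 <= d < n) (\sum_(i < d.+1) nsq f (i : nat, (d - i)%N))%:E
                = (dsum (nsq f) n)%:E)%E.
  by rewrite sumEFin big_mkord.
rewrite /hardy2 /= (@esum_dsum _ (nsq f)); last exact: nsq_ge0.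
set S := (\sum_(d <oo) _)%E; split=> [fin|[B fB]].
  have := fin; rewrite -ge0_fin_numE; last exact: nneseries_ge0.
  move=> /fineK finE; exists (fine S) => n.
  by rewrite -lee_fin finE -partE; exact: nneseries_lim_ge.
apply: (@le_lt_trans _ _ B%:E); last exact: ltry.
apply: lime_le; first exact: is_cvg_nneseries.
by apply: nearW => n; rewrite partE lee_fin.
Qed.

Lemma hardy2B (R : realType) (f g : coefs R) :
  hardy2 f -> hardy2 g -> hardy2 (fun p => f p - g p).
Proof.
move=> /hardy2P [B fB] /hardy2P [C gC]; apply/hardy2P.
exists (2 * B + 2 * C) => n.
apply: (@le_trans _ _ (2 * dsum (nsq f) n + 2 * dsum (nsq g) n)); last first.
  by rewrite lerD // ler_wpM2l.
rewrite !(@dsum_morph _ _ ( *%R 2)) ?mulr0 //; try by move=> x y; rewrite mulrDr.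
rewrite -dsumD; apply: ler_dsum => p; rewrite /= !nsqE.
case: (f p) (g p) => [a b] [c d] /=.
rewrite -subr_ge0 (_ : _ - _ = (a + c) ^+ 2 + (b + d) ^+ 2); last by ring.
by rewrite addr_ge0 ?sqr_ge0.
Qed.

Lemma hardy2_fin (R : realType) (f : coefs R) N :
  (forall p, (N <= p.1 + p.2)%N -> f p = 0) -> hardy2 f.
Proof.
move=> f0; apply/hardy2P; exists (dsum (nsq f) N) => n.
have [nN|Nn] := leqP n N; first by apply: dsum_homo => // p; exact: nsq_ge0.
rewrite (eq_dsum (v := fun p => if (p.1 + p.2 < N)%N then nsq f p else 0)).
  rewrite -(subnKC (ltnW Nn)) /dsum big_split_ord /= [X in _ + X]big1 ?addr0.
    apply: ler_sum => d _; apply: ler_sum => i _; case: ifP => // _.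
    exact: nsq_ge0.
  by move=> d _; apply: big1 => i _; rewrite subnKC ?leq_ord // ltnNge leq_addr.
move=> p _; case: ltnP => // /f0 fp; by rewrite nsqE fp /= expr0n addr0.
Qed.

Lemma norm_Re_cprod (R : realType) (f g : coefs R) p :
  `|Re (cprod f g p)| <= nsq f p + nsq g p.
Proof.
rewrite Re_cprod !nsqE; case: (f p) (g p) => [a b] [c d] /=.
rewrite ler_norml; apply/andP; split; rewrite -subr_ge0.
  rewrite (_ : _ - _ = ((a + c) ^+ 2 + (b + d) ^+ 2 + a ^+ 2 + b ^+ 2 + c ^+ 2 + d ^+ 2) / 2);
  last by field.
  by rewrite divr_ge0 // !addr_ge0 ?sqr_ge0.
rewrite (_ : _ - _ = ((a - c) ^+ 2 + (b - d) ^+ 2 + a ^+ 2 + b ^+ 2 + c ^+ 2 + d ^+ 2) / 2);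
  last by field.
by rewrite divr_ge0 // !addr_ge0 ?sqr_ge0.
Qed.

Lemma norm_Im_cprod (R : realType) (f g : coefs R) p :
  `|Im (cprod f g p)| <= nsq f p + nsq g p.
Proof.
rewrite Im_cprod !nsqE; case: (f p) (g p) => [a b] [c d] /=.
rewrite ler_norml; apply/andP; split; rewrite -subr_ge0.
  rewrite (_ : _ - _ = ((b + c) ^+ 2 + (a - d) ^+ 2 + a ^+ 2 + b ^+ 2 + c ^+ 2 + d ^+ 2) / 2);
  last by field.
  by rewrite divr_ge0 // !addr_ge0 ?sqr_ge0.
rewrite (_ : _ - _ = ((b - c) ^+ 2 + (a + d) ^+ 2 + a ^+ 2 + b ^+ 2 + c ^+ 2 + d ^+ 2) / 2);
  last by field.
by rewrite divr_ge0 // !addr_ge0 ?sqr_ge0.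
Qed.

Lemma hdot_cvg (R : realType) (f g : coefs R) : hardy2 f -> hardy2 g ->
  (fun n => Re (dsum (cprod f g) n)) @ \oo --> Re (hdot f g) /\
  (fun n => Im (dsum (cprod f g) n)) @ \oo --> Im (hdot f g).
Proof.
move=> /hardy2P [B fB] /hardy2P [C gC].
have bnd n : dsum (fun p => nsq f p + nsq g p) n <= B + C.
  by rewrite dsumD lerD.
split.
  have [a [ca sa]] := dsum_cvg (@norm_Re_cprod _ f g) bnd.
  rewrite (_ : (fun n => _) = dsum (@Re R \o cprod f g)); last first.
    by apply/funext => n; rewrite (dsum_morph _ _ _ (@ReD R)).
  rewrite [X in _ --> X](_ : _ = a) // /hdot /=; apply: cvg_lim => //.
  rewrite (_ : (fun n => _) = square_sum (@Re R \o cprod f g)) //.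
  by apply/funext => n; rewrite -(square_sum_morph _ _ _ (@ReD R)).
have [a [ca sa]] := dsum_cvg (@norm_Im_cprod _ f g) bnd.
rewrite (_ : (fun n => _) = dsum (@Im R \o cprod f g)); last first.
  by apply/funext => n; rewrite (dsum_morph _ _ _ (@ImD R)).
rewrite [X in _ --> X](_ : _ = a) // /hdot /=; apply: cvg_lim => //.
rewrite (_ : (fun n => _) = square_sum (@Im R \o cprod f g)) //.
by apply/funext => n; rewrite -(square_sum_morph _ _ _ (@ImD R)).
Qed.

(** The offset [a] absorbs the degree gained by a multiplication operator: the adjoint relations
    hold between sums over degrees below n + 1 and below n. *)
Lemma hdot_eq (R : realType) (f g f' g' : coefs R) (a : nat) :
  hardy2 f -> hardy2 g -> hardy2 f' -> hardy2 g' ->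
  (forall n, dsum (cprod f g) (n + a)%N = dsum (cprod f' g') n) ->
  hdot f g = hdot f' g'.
Proof.
move=> hf hg hf' hg' E.
have [r i] := hdot_cvg hf hg; have [r' i'] := hdot_cvg hf' hg'.
have shift (phi : R[i] -> R) (x : R) : phi (dsum (cprod f g) n) @[n --> \oo] --> x ->
    phi (dsum (cprod f' g') n) @[n --> \oo] --> x.
  rewrite -(cvg_shiftn a); rewrite [X in X @ _ --> _ -> _](_ : _ =
    fun n => phi (dsum (cprod f' g') n)) //.
  by apply/funext => n /=; rewrite E.
by apply: complex_eqP;
  [rewrite -(cvg_lim _ r') // -(cvg_lim _ (shift _ _ r))
  |rewrite -(cvg_lim _ i') // -(cvg_lim _ (shift _ _ i))].
Qed.

Lemma hdot_const (R : realType) (f g : coefs R) (c : R[i]) N :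
  hardy2 f -> hardy2 g ->
  (forall n, (N <= n)%N -> dsum (cprod f g) n = c) -> hdot f g = c.
Proof.
move=> hf hg E; have [r i] := hdot_cvg hf hg.
have E' n : (N <= n)%N -> dsum (cprod f g) n = c by exact: E.
have [cr ci] : Re c = Re (hdot f g) /\ Im c = Im (hdot f g).
  split; [rewrite -(cvg_lim _ r) //|rewrite -(cvg_lim _ i) //]; apply/esym;
    apply: cvg_lim => //; apply: cvg_near_cst; near=> n;
    by rewrite E' //; near: n; exact: nbhs_infty_ge.
exact: complex_eqP.
Unshelve. all: by end_near.
Qed.

(** * Class sums and class averages *)

Definition csum (V : nmodType) (k : nat) (u : nat * nat -> V) (p : nat * nat) : V :=
  \sum_(i < (p.1 + p.2).+1 | i == p.1 %[mod k]) u (i : nat, (p.1 + p.2 - i)%N).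

(** Taking the size to be the class sum of the constant 1 makes every identity for class sums, in
    particular the shift formulas, apply to sizes. *)
Definition csize (k : nat) (p : nat * nat) : nat := csum k (fun=> 1%N) p.

Definition cavg (R : realType) (k : nat) (f : coefs R) : coefs R :=
  fun p => csum k f p / (csize k p)%:R.

Definition cproj (R : realType) (k : nat) (f : coefs R) : coefs R :=
  fun p => f p - cavg k f p.

Definition sameclass (k : nat) (p q : nat * nat) : Prop :=
  (p.1 + p.2 = q.1 + q.2)%N /\ p.1 = q.1 %[mod k].

Lemma csumE (V : nmodType) k (u : nat * nat -> V) i j d : (i + j)%N = d ->
  csum k u (i, j) = \sum_(l < d.+1 | l == i %[mod k]) u (l : nat, (d - l)%N).
Proof. by move=> <-. Qed.

Lemma csum_class (V : nmodType) k (u : nat * nat -> V) p q :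
  sameclass k p q -> csum k u p = csum k u q.
Proof.
case: p q => [i j] [i' j'] [/= pq e].
by rewrite (csumE _ _ pq) (csumE _ _ (erefl (i' + j')%N)) e.
Qed.

Lemma eq_csum (V : nmodType) k (u v : nat * nat -> V) p :
  (forall q, sameclass k q p -> u q = v q) -> csum k u p = csum k v p.
Proof.
move=> uv; apply: eq_bigr => i /eqP ip; apply: uv; split => //=.
by rewrite subnKC // -ltnS.
Qed.

Lemma csum0 (V : nmodType) k (u : nat * nat -> V) p :
  (forall q, sameclass k q p -> u q = 0) -> csum k u p = 0.
Proof.
move=> u0; transitivity (csum k (fun=> 0 : V) p); first exact: eq_csum.
by rewrite /csum big1.
Qed.

Lemma csumB (V : zmodType) k (u v : nat * nat -> V) p :
  csum k (fun q => u q - v q) p = csum k u p - csum k v p.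
Proof. exact: sumrB. Qed.

Lemma csum_const (V : nmodType) k (x : V) p :
  csum k (fun=> x) p = x *+ csize k p.
Proof.
rewrite /csize /csum (big_morph (fun m => x *+ m) (id1 := 0) (op1 := +%R)) //.
by move=> m1 m2; exact: mulrnDr.
Qed.

Lemma csize_gt0 k p : (0 < csize k p)%N.
Proof.
case: p => i j; rewrite /csize /csum /=.
have ip : (i < (i + j).+1)%N by rewrite ltnS leq_addr.
by rewrite (bigD1 (Ordinal ip)).
Qed.

Lemma cavg_class (R : realType) k (f : coefs R) p q :
  sameclass k p q -> cavg k f p = cavg k f q.
Proof. by move=> pq; rewrite /cavg /csize !(csum_class _ pq). Qed.

Lemma csize_neq0 (R : realType) k p : (csize k p)%:R != 0 :> R[i].
Proof. by rewrite pnatr_eq0 -lt0n csize_gt0. Qed.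

Lemma csum_invariant (R : realType) k (f : coefs R) p :
  (forall q, sameclass k q p -> f q = f p) ->
  csum k f p = f p * (csize k p)%:R.
Proof.
by move=> fp; rewrite (@eq_csum _ _ _ (fun=> f p)) // csum_const mulr_natr.
Qed.

Lemma cproj_invariant (R : realType) k (f : coefs R) p :
  (forall q, sameclass k q p -> f q = f p) -> cproj k f p = 0.
Proof.
move=> fp; rewrite /cproj /cavg csum_invariant // mulfK ?subrr //.
exact: csize_neq0.
Qed.

Lemma csum_cproj (R : realType) k (f : coefs R) p : csum k (cproj k f) p = 0.
Proof.
rewrite /cproj csumB (csum_invariant (f := cavg k f)); last first.
  by move=> q; exact: cavg_class.
by rewrite /cavg divfK ?subrr // csize_neq0.
Qed.

Lemma cproj_id (R : realType) k (f : coefs R) :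
  (forall p, csum k f p = 0) -> cproj k f = f.
Proof.
by move=> f0; apply/funext => p; rewrite /cproj /cavg f0 mul0r subr0.
Qed.

Lemma cprojB (R : realType) k (f g : coefs R) p :
  cproj k (fun q => f q - g q) p = cproj k f p - cproj k g p.
Proof. by rewrite /cproj /cavg csumB mulrBl; ring. Qed.

(** In each degree both sides are a sum over pairs of indices of one class, weighted by the inverse
    class size. The weight is constant on the class, so the two indices can exchange roles. *)
Lemma dsum_cavg (R : realType) k (f g : coefs R) n :
  dsum (cprod (cavg k f) g) n = dsum (cprod f (cavg k g)) n.
Proof.
apply: eq_bigr => d _; rewrite /cprod /cavg.
transitivity (\sum_(i < d.+1) \sum_(l < d.+1 | l == i %[mod k])
   (f (l : nat, (d - l)%N) / (csize k (i : nat, (d - i)%N))%:R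
      * (g (i : nat, (d - i)%N))^*)).
  apply: eq_bigr => i _; rewrite (@csumE _ _ _ _ _ d) ?subnKC ?leq_ord //.
  by rewrite !mulr_suml.
rewrite (exchange_big_dep xpredT) //=; apply: eq_bigr => l _.
rewrite (@csumE _ _ _ _ _ d) ?subnKC ?leq_ord // rmorphM fmorphV rmorph_nat.
rewrite rmorph_sum mulr_suml mulr_sumr.
rewrite (eq_bigl (fun i : 'I_d.+1 => i == l %[mod k])); last first.
  by move=> i /=; rewrite eq_sym.
apply: eq_bigr => i /eqP il.
have -> : csize k (i : nat, (d - i)%N) = csize k (l : nat, (d - l)%N).
  by apply: csum_class; split; rewrite //= !subnKC ?leq_ord.
by rewrite -mulrA [_^-1 * _]mulrC.
Qed.

Lemma dsum_cproj (R : realType) k (f g : coefs R) n :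
  dsum (cprod (cproj k f) g) n = dsum (cprod f (cproj k g)) n.
Proof.
transitivity (dsum (cprod f g) n - dsum (cprod (cavg k f) g) n).
  by rewrite -dsumB; apply: eq_dsum => p _; rewrite /cprod /cproj mulrBl.
rewrite dsum_cavg -dsumB; apply: eq_dsum => p _.
by rewrite /cprod /cproj rmorphB mulrBr.
Qed.

Lemma cproj_idem (R : realType) k (f : coefs R) :
  cproj k (cproj k f) = cproj k f.
Proof. by apply: cproj_id => p; exact: csum_cproj. Qed.

(* AM-GM on the identity |Pf|^2 = Re <f, Pf>. *)
Lemma hardy2_cproj (R : realType) k (f : coefs R) :
  hardy2 f -> hardy2 (cproj k f).
Proof.
move=> /hardy2P [B fB]; apply/hardy2P; exists B => n; apply: le_trans (fB n).
have E : dsum (nsq (cproj k f)) n = dsum (fun p => Re (cprod f (cproj k f) p)) n.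
  transitivity (Re (dsum (cprod (cproj k f) (cproj k f)) n)).
    rewrite (dsum_morph _ _ _ (@ReD R)) //.
    by apply: eq_dsum => p _; rewrite /= Re_cprod_diag.
  by rewrite dsum_cproj cproj_idem (dsum_morph _ _ _ (@ReD R)).
have : dsum (fun p => Re (cprod f (cproj k f) p) + Re (cprod f (cproj k f) p)) n
       <= dsum (fun p => nsq f p + nsq (cproj k f) p) n.
  apply: ler_dsum => p; rewrite Re_cprod !nsqE.
  case: (f p) (cproj k f p) => [a b] [c d] /=; rewrite -subr_ge0.
  rewrite (_ : _ - _ = (a - c) ^+ 2 + (b - d) ^+ 2); last by ring.
  by rewrite addr_ge0 ?sqr_ge0.
by rewrite !dsumD -E; lra.
Qed.

(** * Class sums under shifts and at multiples of k *)

Lemma csum_shiftz (V : nmodType) k (u : nat * nat -> V) i j :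
  csum k u (i.+1, j) = csum k (fun p => u (p.1.+1, p.2)) (i, j)
    + (if (k %| i.+1)%N then u (0%N, (i + j).+1) else 0).
Proof.
rewrite (@csumE _ _ _ _ _ (i + j).+1) // (@csumE _ _ _ _ _ (i + j)) //.
rewrite big_mkcond big_ord_recl [LHS]addrC [in RHS]big_mkcond /= subn0.
congr (_ + _); last by rewrite mod0n eq_sym.
apply: eq_bigr => l _.
by rewrite /bump /= !add1n subSS -(addn1 l) -(addn1 i) eqn_modDr.
Qed.

Lemma csum_shiftw (V : nmodType) k (u : nat * nat -> V) i j :
  csum k u (i, j.+1) = csum k (fun p => u (p.1, p.2.+1)) (i, j)
    + (if (k %| j.+1)%N then u ((i + j).+1, 0%N) else 0).
Proof.
rewrite (@csumE _ _ _ _ _ (i + j).+1) ?addnS // (@csumE _ _ _ _ _ (i + j)) //.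
rewrite big_mkcond big_ord_recr [in RHS]big_mkcond /= subnn.
congr (_ + _); last first.
  (* The end point has first coordinate i + j.+1, congruent to i exactly when k divides j.+1. *)
  by rewrite -addnS -[X in _ == X %[mod k]]addn0 eqn_modDl mod0n.
by apply: eq_bigr => l _; rewrite subSn // leq_ord.
Qed.

(** The block of indices from k N + 1 to k N + k contains one multiple of k, its last element. *)
Lemma sum_multiples (V : nmodType) k (F : nat -> V) N : (0 < k)%N ->
  \sum_(l < (k * N).+1 | (k %| l)%N) F l = \sum_(l < N.+1) F (k * l)%N.
Proof.
move=> k0; elim: N => [|N IHN].
  by rewrite muln0 big_mkcond !big_ord_recr !big_ord0 /= muln0 dvdn0.
rewrite [RHS]big_ord_recr /= -IHN mulnSr.
have -> : (k * N + k).+1 = ((k * N).+1 + k)%N by rewrite addSn.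
rewrite big_mkcond big_split_ord /= -big_mkcond; congr (_ + _).
case: k k0 => // k _ in IHN *.
rewrite big_ord_recr /= big1 ?add0r.
  by rewrite addSnnS dvdn_addr ?dvdn_mulr // dvdnn.
move=> i _; rewrite addSnnS dvdn_addr ?dvdn_mulr // gtnNdvd //.
by rewrite ltnS.
Qed.

Lemma csum_mult (V : nmodType) k (u : nat * nat -> V) a b : (0 < k)%N ->
  csum k u (k * a, k * b)%N =
  \sum_(l < (a + b).+1) u (k * l, k * (a + b - l))%N.
Proof.
move=> k0; rewrite (@csumE _ _ _ _ _ (k * (a + b))%N); last by rewrite mulnDr.
transitivity (\sum_(l < (k * (a + b)).+1 | (k %| l)%N)
                u (l : nat, (k * (a + b) - l)%N)).
  by apply: eq_bigl => l; rewrite modnMr.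
rewrite (@sum_multiples _ _ (fun l => u (l, (k * (a + b) - l)%N))) //.
by apply: eq_bigr => l _; rewrite mulnBr.
Qed.

Lemma csize_mult k a b : (0 < k)%N -> csize k (k * a, k * b)%N = (a + b).+1.
Proof.
move=> k0; rewrite /csize csum_mult //.
exact: etrans (sum1_card 'I_(a + b).+1) (card_ord _).
Qed.

(** * The submodule generated by z^k - w^k *)

Lemma nsq_cvg (R : realType) (f : coefs R) : hardy2 f ->
  dsum (nsq f) @ \oo --> Re (hdot f f).
Proof.
move=> hf; have [r _] := hdot_cvg hf hf.
rewrite (_ : dsum (nsq f) = fun n => Re (dsum (cprod f f) n)) //.
apply/funext => n; rewrite (dsum_morph _ _ _ (@ReD R)) //.
by apply: eq_dsum => p _; rewrite /= Re_cprod_diag.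
Qed.

Lemma nsq_le_hdot (R : realType) (f : coefs R) n : hardy2 f ->
  dsum (nsq f) n <= Re (hdot f f).
Proof.
move=> hf; have c := nsq_cvg hf; rewrite -(cvg_lim _ c) //.
apply: nondecreasing_cvgn_le; last by apply/cvg_ex; exists (Re (hdot f f)).
by apply: dsum_homo => p; exact: nsq_ge0.
Qed.

(** Continuity of coefficients for the norm; it carries the vanishing of class sums from the
    multiples of z^k - w^k to their closure. *)
Lemma normc_le_hnorm (R : realType) (f : coefs R) p : hardy2 f ->
  normc (f p) <= hnorm f.
Proof.
move=> hf; have n0 : 0 <= normc (f p) by case: (f p) => a b; exact: sqrtr_ge0.
rewrite /hnorm -(ger0_norm n0) -sqrtr_sqr ler_wsqrtr //.
apply: le_trans (nsq_le_hdot (p.1 + p.2).+1 hf).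
by apply: (@ler_dsum_term _ (nsq f)) => q; exact: nsq_ge0.
Qed.

Lemma hnorm_lt (R : realType) (f : coefs R) (e B : R) : hardy2 f ->
  (forall n, dsum (nsq f) n <= B) -> 0 < e -> B < e ^+ 2 -> hnorm f < e.
Proof.
move=> hf fB e0 Be; have c := nsq_cvg hf.
have lB : Re (hdot f f) <= B.
  rewrite -(cvg_lim _ c) //; apply: limr_le; first by apply/cvg_ex; exists (Re (hdot f f)).
  by apply: nearW => n; exact: fB.
rewrite /hnorm -(ger0_norm (ltW e0)) -sqrtr_sqr ltr_sqrt ?exprn_gt0 //.
exact: le_lt_trans Be.
Qed.

Lemma normc_csum (R : realType) k (f : coefs R) p (e : R) :
  (forall q, normc (f q) <= e) -> normc (csum k f p) <= (csize k p)%:R * e.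
Proof.
move=> fe; rewrite mulr_natl -csum_const /csum.
elim/big_ind2: _ => [|x a y b xa yb|i _] //; first by rewrite ComplexField.Normc.normc0.
by apply: le_trans (le_normcD _ _) _; rewrite lerD.
Qed.

(** * Multiples of z^k - w^k and division *)

Lemma modn_addl_neq k i t : (0 < t < k)%N -> (i + t == i %[mod k]) = false.
Proof.
move=> /andP[t0 tk]; rewrite -[X in _ == X %[mod k]]addn0 eqn_modDl mod0n.
by rewrite modn_small // eqn0Ngt t0.
Qed.

(** Multiplication by z^k and by w^k send an index to two indices of the same degree and residue, so
    z^k u and w^k u have equal class sums. *)
Lemma csum_shift_eq (V : nmodType) k (u : nat * nat -> V) p :
  csum k (fun p => if (p.1 < k)%N then 0 else u (p.1 - k, p.2)%N) p =
  csum k (fun p => if (p.2 < k)%N then 0 else u (p.1, p.2 - k)%N) p.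
Proof.
case: p => r j; rewrite !(@csumE _ _ _ _ _ (r + j)) //; move: (r + j)%N => d.
have [dk|kd] := ltnP d k.
  rewrite !big1 // => i _ /=.
    by rewrite (leq_ltn_trans (leq_subr _ _) dk).
  by rewrite (leq_ltn_trans (leq_ord i) dk).
rewrite -(subnK kd); move: (d - k)%N => m.
rewrite big_mkcond [RHS]big_mkcond.
rewrite [in RHS](_ : (m + k).+1 = (m.+1 + k)%N) //.
rewrite [in LHS](_ : (m + k).+1 = (k + m.+1)%N); last by rewrite addnS addnC.
(* The left sum loses its first k terms, the right one its last k; the m.+1 remaining terms
   agree. *)
rewrite !big_split_ord /= [X in X + _]big1 ?add0r; last first.
  by move=> i _; rewrite ltn_ord; case: ifP.
rewrite [X in _ = _ + X]big1 ?addr0; last first.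
  move=> i _; rewrite (_ : m + k - (m.+1 + i) < k)%N; first by case: ifP.
  by have := ltn_ord i; lia.
apply: eq_bigr => i _; have im := ltn_ord i.
rewrite modnDl ltnNge leq_addr /= addKn ltnNge (_ : k <= m + k - i)%N; last by lia.
by rewrite (_ : m + k - (k + i) = m + k - i - k)%N //; lia.
Qed.

Lemma coefs_of_poly_mul (R : realType) k (q : {poly {poly R[i]}}) p :
  coefs_of_poly (('X^k - ('X^k)%:P) * q) p =
  (if (p.1 < k)%N then 0 else coefs_of_poly q (p.1 - k, p.2)%N) -
  (if (p.2 < k)%N then 0 else coefs_of_poly q (p.1, p.2 - k)%N).
Proof.
rewrite /coefs_of_poly mulrBl !coefB coefXnM coefCM coefXnM.
by case: ifP => //; rewrite coef0.
Qed.

Lemma csum_coefs_of_poly (R : realType) k (q : {poly {poly R[i]}}) p :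
  csum k (coefs_of_poly (('X^k - ('X^k)%:P) * q)) p = 0.
Proof.
rewrite (eq_csum (fun q' _ => coefs_of_poly_mul k q q')) csumB.
by rewrite csum_shift_eq subrr.
Qed.

Lemma hardy2_coefs_of_poly (R : realType) (q : {poly {poly R[i]}}) :
  hardy2 (coefs_of_poly q).
Proof.
pose N := (size q + \max_(i < size q) size (q`_i)%R)%N.
apply: (@hardy2_fin _ _ N) => -[i j] /= Nij; rewrite /coefs_of_poly /=.
have [iq|qi] := ltnP i (size q); last by rewrite [q`_i]nth_default // coef0.
rewrite nth_default // -(leq_add2l (size q)).
apply: leq_trans (leq_trans Nij (leq_add (ltnW iq) (leqnn j))).
rewrite leq_add2l.
exact: (@leq_bigmax _ (fun i : 'I_(size q) => size (q`_i)%R) (Ordinal iq)).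
Qed.

(** The members of a residue class are k apart, so one step of length k adds one term; this is the
    recursion that division by z^k - w^k has to solve. *)
Lemma sum_class_rec (V : nmodType) k (F : nat -> V) i : (0 < k)%N ->
  \sum_(l < i.+1 | l == i %[mod k]) F l =
  (if (i < k)%N then 0 else \sum_(l < (i - k).+1 | l == i - k %[mod k]) F l)
  + F i.
Proof.
move=> k0; rewrite big_mkcond big_ord_recr /= eqxx; congr (_ + _).
case: ltnP => [ik|ki].
  rewrite big1 // => l _; have li := ltn_ord l.
  by rewrite !modn_small ?(ltn_trans li) // ltn_eqF.
rewrite -(subnK ki); move: (i - k)%N => m; rewrite addnK modnDr.
have E : (m + k)%N = (m.+1 + k.-1)%N by rewrite addSnnS prednK.
rewrite [in LHS]E big_split_ord /= -big_mkcond [X in _ + X]big1 ?addr0 //.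
move=> l _; rewrite addSnnS modn_addl_neq //.
by have := ltn_ord l; lia.
Qed.

(** The next member of the class would be (i + k, j - k), outside the quadrant, so the partial sum
    up to i is already complete. *)
Lemma csum_partial (V : nmodType) k (u : nat * nat -> V) i j : (j < k)%N ->
  csum k u (i, j) =
  \sum_(l < i.+1 | l == i %[mod k]) u (l : nat, (i + j - l)%N).
Proof.
move=> jk; rewrite (@csumE _ _ _ _ _ (i + j)) // -addSn big_mkcond.
rewrite big_split_ord /= -big_mkcond /= [X in _ + X]big1 ?addr0 //.
move=> l _; rewrite addSnnS modn_addl_neq //.
by have := ltn_ord l; lia.
Qed.

(* Dividing by z^k - w^k: along each class the quotient is a partial sum of the
   coefficients, and it terminates because the total class sum vanishes. *)
Lemma divisible_of_csum0 (R : realType) k (f : coefs R) N : (0 < k)%N ->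
  (forall p, (N <= p.1 + p.2)%N -> f p = 0) -> (forall p, csum k f p = 0) ->
  exists q, coefs_of_poly (('X^k - ('X^k)%:P) * q) = f.
Proof.
move=> k0 fN f0.
pose r i j := \sum_(l < i.+1 | l == i %[mod k]) f (l : nat, (i + j - l)%N).
have rN i j : (N <= i + j)%N -> r i j = 0.
  move=> Nij; apply: big1 => l _; apply: fN => /=.
  by have := ltn_ord l; lia.
(* Comparing coefficients asks for f(i, j) = q(i - k, j) - q(i, j - k), and [sum_class_rec] solves
   this with q(i, j) = - r(i, j + k). The cut-offs at N lose nothing, since r vanishes from degree N
   on. *)
pose q : {poly {poly R[i]}} := \poly_(i < N) \poly_(j < N) - r i (j + k)%N.
have qE i j : coefs_of_poly q (i, j) = - r i (j + k)%N.
  rewrite /coefs_of_poly /= coef_poly; case: ltnP => iN.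
    by rewrite coef_poly; case: ltnP => // jN; rewrite rN ?oppr0 //; lia.
  by rewrite coef0 rN ?oppr0 //; lia.
exists q; apply/funext => -[i j]; rewrite coefs_of_poly_mul /= !qE.
have -> : (if (j < k)%N then 0 else - r i (j - k + k)%N) = - r i j.
  case: ltnP => jk; last by rewrite subnK.
  by rewrite /r -csum_partial // f0 oppr0.
rewrite opprK {2}/r (@sum_class_rec _ _ (fun l => f (l, (i + j - l)%N))) // addKn.
case: ltnP => ik; first by rewrite !add0r.
rewrite addrA /r (_ : i - k + (j + k) = i + j)%N; last by lia.
by rewrite addNr add0r.
Qed.

(** A class sum is a finite sum of coefficients, hence bounded by the class size times the distance
    from f to any multiple of z^k - w^k. Conversely, truncating f by degree keeps all class sums
    zero and gives an exact multiple, with a tail of f as error. *)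
Lemma poly_submoduleP (R : realType) k (f : coefs R) : (0 < k)%N ->
  poly_submodule ('X^k - ('X^k)%:P) f <->
  hardy2 f /\ forall p, csum k f p = 0.
Proof.
move=> k0; split => [[hf fq]|[hf f0]]; split => //.
  move=> p; apply: ComplexField.Normc.eq0_normc; apply/eqP.
  have n0 : 0 <= normc (csum k f p) by case: (csum k f p) => a b; exact: sqrtr_ge0.
  rewrite eq_le n0 andbT; apply/ler_addgt0Pr => e e0; rewrite add0r.
  have c0 : 0 < (csize k p)%:R :> R by rewrite ltr0n csize_gt0.
  have [q qe] := fq _ (divr_gt0 e0 c0).
  have hg := hardy2B hf (hardy2_coefs_of_poly (('X^k - ('X^k)%:P) * q)).
  set g := (fun ij => _) in qe hg.
  have -> : csum k f p = csum k g p.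
    by rewrite /g csumB csum_coefs_of_poly subr0.
  rewrite -[e](divfK (lt0r_neq0 c0)) mulrC; apply: normc_csum => x.
  by rewrite ltW // (le_lt_trans (normc_le_hnorm _ hg)).
move=> e e0.
have e20 : 0 < e ^+ 2 by rewrite exprn_gt0.
have [N fN] : exists N, Re (hdot f f) - dsum (nsq f) N < e ^+ 2.
  have /cvgrPdist_lt /(_ _ e20) [N _ /(_ N (leqnn N)) fN] := nsq_cvg hf.
  by exists N; apply: le_lt_trans (ler_norm _) fN.
pose fN0 : coefs R := fun p => if (p.1 + p.2 < N)%N then f p else 0.
have [||q qE] := @divisible_of_csum0 _ k fN0 N k0.
- by move=> p; rewrite /fN0 ltnNge => ->.
- move=> p; have [pN|Np] := ltnP (p.1 + p.2) N.
    by rewrite -(f0 p); apply: eq_csum => q [qp _]; rewrite /fN0 qp pN.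
  by apply: csum0 => q [qp _]; rewrite /fN0 qp ltnNge Np.
exists q; rewrite qE.
have hfN : hardy2 fN0.
  by apply: (@hardy2_fin _ _ N) => p; rewrite /fN0 ltnNge => ->.
apply: (hnorm_lt (hardy2B hf hfN) _ e0 fN) => n.
have tail p : nsq (fun p => f p - fN0 p) p <= nsq f p.
  rewrite /fN0 !nsqE; case: ifP => _; rewrite ?subr0 //.
  by rewrite subrr /= expr0n addr0 addr_ge0 ?sqr_ge0.
have tail0 p : (p.1 + p.2 < N)%N -> nsq (fun p => f p - fN0 p) p = 0.
  by move=> pN; rewrite nsqE /fN0 pN subrr /= expr0n addr0.
have [nN|Nn] := leqP n N.
  rewrite (eq_dsum (v := fun=> 0)) => [|p pn]; last by rewrite tail0 // (leq_trans pn).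
  by rewrite dsum0 // subr_ge0 nsq_le_hdot.
apply: le_trans (ler_norm _) _.
apply: le_trans (ler_norm_dsum _ tail0 (ltnW Nn)) _.
  by move=> p; rewrite ger0_norm ?tail // nsq_ge0.
by rewrite lerB ?nsq_le_hdot.
Qed.

(** * The core operator *)

Lemma dsum_single (V : nmodType) (u : nat * nat -> V) p n :
  (forall q, q <> p -> u q = 0) -> (p.1 + p.2 < n)%N -> dsum u n = u p.
Proof.
move=> u0 pn; rewrite /dsum (bigD1 (Ordinal pn)) //=.
have p1 : (p.1 < (p.1 + p.2).+1)%N by rewrite ltnS leq_addr.
rewrite (bigD1 (Ordinal p1)) //= addKn -surjective_pairing.
rewrite big1 ?addr0; last first.
  by move=> i /eqP ip; apply: u0 => e; apply: ip; apply: val_inj; rewrite /= -[in RHS]e.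
rewrite big1 ?addr0 // => d /eqP dp; rewrite big1 // => i _; apply: u0 => e.
by apply: dp; apply: val_inj; rewrite /= -[in RHS]e /= subnKC // leq_ord.
Qed.

Definition delta (R : realType) (p : nat * nat) : coefs R :=
  fun q => if q == p then 1 else 0.

Lemma hardy2_delta (R : realType) p : hardy2 (delta R p).
Proof.
apply: (@hardy2_fin _ _ (p.1 + p.2).+1) => q qp; rewrite /delta; case: eqP => // e.
by move: qp; rewrite e ltnn.
Qed.

Lemma dsum_delta (R : realType) (f : coefs R) p n : (p.1 + p.2 < n)%N ->
  dsum (cprod f (delta R p)) n = f p.
Proof.
move=> pn; rewrite (dsum_single (p := p)) //.
  by rewrite /cprod /delta eqxx conjC1 mulr1.
by move=> q /eqP/negPf qp; rewrite /cprod /delta qp conjC0 mulr0.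
Qed.

Lemma dsum_cprodC (R : realType) (f g : coefs R) n :
  dsum (cprod f g) n = (dsum (cprod g f) n)^*.
Proof.
rewrite (dsum_morph _ _ (@conjC0 _) (rmorphD Num.conj)).
by apply: eq_dsum => p _; rewrite /= /cprod rmorphM /= conjCK mulrC.
Qed.

Section PolySubmodule.
Variables (R : realType) (k : nat).
Hypothesis k_gt0 : (0 < k)%N.

Let M : set (coefs R) := poly_submodule ('X^k - ('X^k)%:P).

Lemma submodule_hardy2 f : M f -> hardy2 f.
Proof. by case. Qed.

Lemma cproj_submodule f : M f -> cproj k f = f.
Proof. by move=> /(poly_submoduleP _ k_gt0)[_]; exact: cproj_id. Qed.

Lemma submodule_cproj f : hardy2 f -> M (cproj k f).
Proof.
move=> hf; apply/(poly_submoduleP _ k_gt0); split; first exact: hardy2_cproj.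
exact: csum_cproj.
Qed.

(** [cproj k (delta R p)] represents in M the functional taking the coefficient at p: for f in M the
    right-hand side is f p. *)
Lemma hdot_cproj_delta f p : hardy2 f -> hdot f (cproj k (delta R p)) = cproj k f p.
Proof.
move=> hf; have hd := hardy2_cproj k (hardy2_delta R p).
apply: (@hdot_const _ _ _ _ (p.1 + p.2).+1) => // n pn.
by rewrite -dsum_cproj dsum_delta.
Qed.

Lemma hdot_delta_submodule f p : M f ->
  hdot (cproj k (delta R p)) f = (f p)^*.
Proof.
move=> Mf; have hd := hardy2_cproj k (hardy2_delta R p).
apply: (@hdot_const _ _ _ _ (p.1 + p.2).+1) => // [|n pn].
  exact: submodule_hardy2.
by rewrite dsum_cproj cproj_submodule // dsum_cprodC dsum_delta.
Qed.

Lemma hprojE f : hardy2 f -> hproj M f = cproj k f.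
Proof.
move=> hf; apply: xget_unique.
  split=> [|h Mh]; first exact: submodule_cproj.
  have hh := submodule_hardy2 Mh; have hP := hardy2_cproj k hf.
  apply: (@hdot_const _ _ _ _ 0) => // [|n _]; first exact: hardy2B.
  rewrite -(cproj_submodule Mh) -dsum_cproj dsum0 // => p.
  by rewrite /cprod cprojB cproj_idem subrr mul0r.
move=> g [Mg ortho]; apply/funext => p.
have /eqP := ortho _ (submodule_cproj (hardy2_delta R p)).
rewrite hdot_cproj_delta; last exact: hardy2B hf (submodule_hardy2 Mg).
by rewrite cprojB (cproj_submodule Mg) subr_eq0 => /eqP.
Qed.

(** The adjoint of a restriction to M is the compression of the ambient adjoint [Ts]. The hypothesis
    compares degrees below n + 1 with degrees below n because the operators T of interest raise the
    degree by one. *)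
Lemma restr_adjE (T Ts : coefs R -> coefs R) f :
  (forall h, hardy2 h -> hardy2 (T h)) ->
  (forall h, hardy2 h -> hardy2 (Ts h)) ->
  (forall h g n, dsum (cprod (T h) g) n.+1 = dsum (cprod h (Ts g)) n) ->
  M f -> restr_adj M T f = cproj k (Ts f).
Proof.
move=> hT hTs adj Mf; have hf := submodule_hardy2 Mf.
have MP := submodule_cproj (hTs _ hf).
have P h : M h -> hdot (T h) f = hdot h (cproj k (Ts f)).
  move=> Mh; have hh := submodule_hardy2 Mh.
  apply: (@hdot_eq _ _ _ _ _ 1) => //; [exact: hT|exact: submodule_hardy2 MP|].
  by move=> n; rewrite addn1 adj -dsum_cproj cproj_submodule.
apply: xget_unique => // g [Mg gP]; apply/funext => p.
have Md := submodule_cproj (hardy2_delta R p).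
have := gP _ Md; rewrite P // !hdot_delta_submodule // => /(congr1 Num.conj).
by rewrite !conjCK.
Qed.

(** * Adjoints of the restricted multiplications *)

Definition zstar (f : coefs R) : coefs R := fun p => f (p.1.+1, p.2).
Definition wstar (f : coefs R) : coefs R := fun p => f (p.1, p.2.+1).

Lemma hardy2_zstar (f : coefs R) : hardy2 f -> hardy2 (zstar f).
Proof.
move=> /hardy2P [B fB]; apply/hardy2P; exists B => n.
apply: le_trans (fB n.+1); rewrite dsum_shiftz lerDr sumr_ge0 // => i _.
exact: nsq_ge0.
Qed.

Lemma hardy2_wstar (f : coefs R) : hardy2 f -> hardy2 (wstar f).
Proof.
move=> /hardy2P [B fB]; apply/hardy2P; exists B => n.
apply: le_trans (fB n.+1); rewrite dsum_shiftw lerDr sumr_ge0 // => i _.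
exact: nsq_ge0.
Qed.

Lemma hardy2_mulz (f : coefs R) : hardy2 f -> hardy2 (mulz f).
Proof.
move=> /hardy2P [B fB]; apply/hardy2P; exists B => -[|n].
  by have := fB 0%N; rewrite /dsum !big_ord0.
rewrite dsum_shiftz big1 ?add0r; last first.
  by move=> j _; rewrite nsqE /= expr0n addr0.
by apply: le_trans (fB n); apply: ler_dsum => -[i j]; exact: lexx.
Qed.

Lemma hardy2_mulw (f : coefs R) : hardy2 f -> hardy2 (mulw f).
Proof.
move=> /hardy2P [B fB]; apply/hardy2P; exists B => -[|n].
  by have := fB 0%N; rewrite /dsum !big_ord0.
rewrite dsum_shiftw big1 ?add0r; last first.
  by move=> j _; rewrite nsqE /= expr0n addr0.
by apply: le_trans (fB n); apply: ler_dsum => -[i j]; exact: lexx.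
Qed.

Lemma restr_adj_mulz f : M f -> restr_adj M (@mulz R) f = cproj k (zstar f).
Proof.
apply: restr_adjE; [exact: hardy2_mulz|exact: hardy2_zstar|].
move=> h g n; rewrite dsum_shiftz big1 ?add0r //.
by move=> j _; rewrite /cprod mul0r.
Qed.

Lemma restr_adj_mulw f : M f -> restr_adj M (@mulw R) f = cproj k (wstar f).
Proof.
apply: restr_adjE; [exact: hardy2_mulw|exact: hardy2_wstar|].
move=> h g n; rewrite dsum_shiftw big1 ?add0r //.
by move=> j _; rewrite /cprod mul0r.
Qed.

(* Backward shifts map functions constant on the classes, i.e. the elements of
   the orthogonal complement, to such functions. *)
Lemma cproj_zstar f : cproj k (zstar (cproj k f)) = cproj k (zstar f).
Proof.
apply/funext => p; rewrite -[RHS]subr0.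
rewrite (_ : zstar (cproj k f) = fun q => zstar f q - zstar (cavg k f) q) //.
rewrite cprojB; congr (_ - _); apply: cproj_invariant => -[i j] [/= e m].
apply: cavg_class; split; rewrite /= ?addSn ?e //.
by apply/eqP; rewrite -addn1 -(addn1 p.1) eqn_modDr m.
Qed.

Lemma cproj_wstar f : cproj k (wstar (cproj k f)) = cproj k (wstar f).
Proof.
apply/funext => p; rewrite -[RHS]subr0.
rewrite (_ : wstar (cproj k f) = fun q => wstar f q - wstar (cavg k f) q) //.
rewrite cprojB; congr (_ - _); apply: cproj_invariant => -[i j] [/= e m].
by apply: cavg_class; split; rewrite /= ?addnS ?e.
Qed.

(** The outer projection absorbs all inner ones, so each term is one projection of a shift of f
    itself. *)
Lemma core_operatorE f p : hardy2 f -> core_operator M f p =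
  cproj k f p - mulz (cproj k (zstar f)) p - mulw (cproj k (wstar f)) p
  + mulz (mulw (cproj k (zstar (wstar f)))) p.
Proof.
move=> hf; rewrite /core_operator hprojE //.
have Mf := submodule_cproj hf.
rewrite !(restr_adj_mulz Mf) !(restr_adj_mulw Mf) restr_adj_mulz.
  by rewrite !(cproj_zstar, cproj_wstar).
exact: submodule_cproj (hardy2_wstar (submodule_hardy2 Mf)).
Qed.

Lemma cproj_zstar_off f i j : ~~ (k %| i.+1)%N ->
  cproj k (zstar f) (i, j) = cproj k f (i.+1, j).
Proof.
move=> /negPf ki.
by rewrite /cproj /cavg /csize !csum_shiftz ki !addr0.
Qed.

Lemma cproj_wstar_off f i j : ~~ (k %| j.+1)%N ->
  cproj k (wstar f) (i, j) = cproj k f (i, j.+1).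
Proof.
move=> /negPf kj.
by rewrite /cproj /cavg /csize !csum_shiftw kj !addr0.
Qed.

(** If k does not divide i, the z-shift matches classes exactly: P f cancels against the z-term and
    the w-term against the mixed term. The case of j is symmetric, as the two backward shifts
    commute. *)
Lemma core_operator_off f i j : hardy2 f -> ~~ ((k %| i) && (k %| j))%N ->
  core_operator M f (i, j) = 0.
Proof.
move=> hf; rewrite negb_and core_operatorE // => /orP [ki|kj].
  case: i ki => [|i] ki; first by rewrite dvdn0 in ki.
  rewrite /mulz /mulw /= cproj_zstar_off //; case: j => [|j] /=; first by ring.
  by rewrite cproj_zstar_off //; ring.
case: j kj => [|j] kj; first by rewrite dvdn0 in kj.
rewrite /mulz /mulw /= cproj_wstar_off //; case: i => [|i] /=; first by ring.
rewrite (_ : zstar (wstar f) = wstar (zstar f)) // cproj_wstar_off //; ring.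
Qed.

(** * Values of C at multiples of k *)

Lemma cavg_mult (f : coefs R) a b : cavg k f (k * a, k * b)%N =
  csum k f (k * a, k * b)%N / (a + b).+1%:R.
Proof. by rewrite /cavg csize_mult. Qed.

(** Writing i.+1 = k a.+1 avoids predecessors. The class of (i.+1, j) has a + b + 2 elements; that
    of (i, j) corresponds to it without the end point (0, (i + j).+1), hence the denominator. *)
Lemma cproj_zstar_mult f i j a b : (i.+1 = k * a.+1)%N -> (j = k * b)%N ->
  cproj k (zstar f) (i, j) = f (i.+1, j) -
    (csum k f (i.+1, j) - f (0%N, (i + j).+1)) / (a + b).+1%:R.
Proof.
move=> ia jb; have ki : (k %| i.+1)%N by rewrite ia dvdn_mulr.
have c : csize k (i, j) = (a + b).+1.
  have := csize_mult a.+1 b k_gt0.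
  rewrite -ia -jb /csize csum_shiftz ki; lia.
rewrite /cproj /cavg c csum_shiftz ki; congr (_ - _ / _); rewrite addrK.
by apply: eq_bigr => l _.
Qed.

Lemma cproj_wstar_mult f i j a b : (i = k * a)%N -> (j.+1 = k * b.+1)%N ->
  cproj k (wstar f) (i, j) = f (i, j.+1) -
    (csum k f (i, j.+1) - f ((i + j).+1, 0%N)) / (a + b).+1%:R.
Proof.
move=> ia jb; have kj : (k %| j.+1)%N by rewrite jb dvdn_mulr.
have c : csize k (i, j) = (a + b).+1.
  have := csize_mult a b.+1 k_gt0.
  rewrite -ia -jb /csize csum_shiftw kj; lia.
rewrite /cproj /cavg c csum_shiftw kj; congr (_ - _ / _); rewrite addrK.
by apply: eq_bigr => l _.
Qed.

(** Both end points drop out of the a + b + 3 elements of the class of (i.+1, j.+1). *)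
Lemma cproj_zwstar_mult f i j a b :
  (i.+1 = k * a.+1)%N -> (j.+1 = k * b.+1)%N ->
  cproj k (zstar (wstar f)) (i, j) = f (i.+1, j.+1) -
    (csum k f (i.+1, j.+1) - f (0%N, (i + j).+2) - f ((i + j).+2, 0%N))
      / (a + b).+1%:R.
Proof.
move=> ia jb.
have ki : (k %| i.+1)%N by rewrite ia dvdn_mulr.
have kj : (k %| j.+1)%N by rewrite jb dvdn_mulr.
have c : csize k (i, j) = (a + b).+1.
  have := csize_mult a.+1 b.+1 k_gt0.
  rewrite -ia -jb /csize csum_shiftw kj csum_shiftz ki; lia.
rewrite /cproj /cavg c csum_shiftw kj addSn csum_shiftz ki.
congr (_ - _ / _); rewrite [in RHS]addrAC addrK addrK.
by apply: eq_bigr => l _.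
Qed.

Lemma core_operator_origin f : hardy2 f -> core_operator M f (0, 0)%N = 0.
Proof.
move=> hf; rewrite core_operatorE // !subr0 addr0.
apply: cproj_invariant => -[i j] [/eqP].
by rewrite addn_eq0 => /andP[/eqP /= -> /eqP ->].
Qed.

Lemma core_operator_left f b : hardy2 f ->
  core_operator M f (0, k * b.+1)%N =
    (csum k f (0, k * b.+1)%N - f (k * b.+1, 0)%N) / b.+1%:R
    - csum k f (0, k * b.+1)%N / b.+2%:R.
Proof.
move=> hf; rewrite core_operatorE // {1}/cproj.
have := cavg_mult f 0 b.+1; rewrite muln0 add0n => ->.
have [j jE] : exists j, (j.+1 = k * b.+1)%N.
  by exists (k * b.+1).-1; rewrite prednK // muln_gt0 k_gt0.
rewrite -jE /mulz /mulw /= (@cproj_wstar_mult _ _ _ 0 b) ?muln0 // add0n.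
by ring.
Qed.

Lemma core_operator_bottom f a : hardy2 f ->
  core_operator M f (k * a.+1, 0)%N =
    (csum k f (k * a.+1, 0)%N - f (0, k * a.+1)%N) / a.+1%:R
    - csum k f (k * a.+1, 0)%N / a.+2%:R.
Proof.
move=> hf; rewrite core_operatorE // {1}/cproj.
have := cavg_mult f a.+1 0; rewrite muln0 addn0 => ->.
have [i iE] : exists i, (i.+1 = k * a.+1)%N.
  by exists (k * a.+1).-1; rewrite prednK // muln_gt0 k_gt0.
rewrite -iE /mulz /mulw /= (@cproj_zstar_mult _ _ _ a 0) ?muln0 // !addn0.
by ring.
Qed.

(** The entry of f at the index itself occurs with signs 1, -1, -1, 1 and cancels, so all inner
    indices of a degree get the same value. With N = a + b + 2, the denominators N + 1, N, N - 1 are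
    the class sizes after dropping none, one or both end points. *)
Lemma core_operator_inner f a b : hardy2 f ->
  let s := csum k f (k * a.+1, k * b.+1)%N in
  let p := f (0, k * (a + b).+2)%N in
  let q := f (k * (a + b).+2, 0)%N in
  core_operator M f (k * a.+1, k * b.+1)%N =
    (s - p) / (a + b).+2%:R + (s - q) / (a + b).+2%:R
    - s / (a + b).+3%:R - (s - p - q) / (a + b).+1%:R.
Proof.
move=> hf; rewrite core_operatorE //= {1}/cproj cavg_mult // addSn addnS.
have [i iE] : exists i, (i.+1 = k * a.+1)%N.
  by exists (k * a.+1).-1; rewrite prednK // muln_gt0 k_gt0.
have [j jE] : exists j, (j.+1 = k * b.+1)%N.
  by exists (k * b.+1).-1; rewrite prednK // muln_gt0 k_gt0.
have ijE : (k * (a + b).+2 = (i + j).+2)%N.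
  by rewrite (_ : (a + b).+2 = a.+1 + b.+1)%N ?mulnDr -?iE -?jE; lia.
rewrite -iE -jE ijE /mulz /mulw /=.
rewrite (@cproj_zstar_mult _ _ _ a b.+1) // (@cproj_wstar_mult _ _ _ a.+1 b) //.
rewrite (@cproj_zwstar_mult _ _ _ a b) // !(addSn, addnS).
by ring.
Qed.

End PolySubmodule.

(** * Eigenvectors *)

Lemma is_eigenvalue_mult (R : realType) (T : coefs R -> coefs R) l :
  multiplicity_ge T l 1 -> is_eigenvalue T l.
Proof.
move=> [v vE vI]; exists (v ord0); first exact: vE.
apply: contrapT => v0.
suff /eqP : (1 : R[i]) = 0 by rewrite oner_eq0.
apply: (vI (fun=> 1) _ ord0) => ij; rewrite big_ord1 mul1r.
by apply/eqP; apply: contraT => vn0; case: v0; exists ij.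
Qed.

Lemma has_multiplicity1 (R : realType) (T : coefs R -> coefs R) l (e : coefs R) p :
  eigenspace_of T l e -> e p != 0 ->
  (forall f, eigenspace_of T l f -> exists c, forall ij, f ij = c * e ij) ->
  has_multiplicity T l 1.
Proof.
move=> eE ep span; split.
  exists (fun=> e) => // c c0 s; move: (c0 p); rewrite (ord1 s) big_ord1 => /eqP.
  by rewrite mulf_eq0 (negPf ep) orbF => /eqP.
move=> [v vE vI].
have /choice [c cE] : forall s, exists c, forall ij, v s ij = c * e ij.
  by move=> s; exact: span (vE s).
(* Coefficients of the relation c1 (c0 e) - c0 (c1 e) = 0. Independence forces c0 = 0, so the first
   vector is zero, which contradicts independence again. *)
pose w (s : 'I_2) := if s == ord0 then c ord_max else - c ord0.
have wI : forall s, w s = 0.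
  apply: vI => ij; rewrite big_ord_recl big_ord1 !cE /w /=.
  have -> : lift ord0 ord0 = ord_max :> 'I_2 by exact: val_inj.
  by ring.
have c0 : c ord0 = 0 by have := wI ord_max; rewrite /w /= => /eqP; rewrite oppr_eq0 => /eqP.
suff /eqP : (1 : R[i]) = 0 by rewrite oner_eq0.
have := vI (fun s => if s == ord0 then 1 else 0) _ ord0; rewrite eqxx; apply=> ij.
by rewrite big_ord_recl big_ord1 !cE c0 /=; ring.
Qed.

(** Adding the eigenvalue equations over the n + 2 indices of a class: p and q are the end values, S
    the sum of the n inner ones. The entries of C f add up to 0, as C f lies in M. *)
Lemma eig_degree_sum (F : numFieldType) n (l s p q S : F) :
  s = p + S + q -> (n = 0%N -> S = 0) ->
  (s - q) / n.+1%:R - s / n.+2%:R = l * p ->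
  (s - p) / n.+1%:R - s / n.+2%:R = l * q ->
  l * S = n%:R * ((s - p) / n.+1%:R + (s - q) / n.+1%:R - s / n.+2%:R
                  - (s - p - q) / n%:R) ->
  l * s = 0.
Proof.
move=> sE S0 Ep Eq ES; rewrite {1}sE !mulrDr ES -Ep -Eq.
(* For n = 0 the quotient by n%:R = 0 is multiplied by 0, so the inner equation does not remove s -
   p - q; [S0] says that this is 0. *)
case: n S0 {Ep Eq ES} => [|n] S0; first by rewrite mul0r sE S0 //; field.
field.
by rewrite -?natrD ?nat1r !pnatr_eq0.
Qed.

Section Eigen.
Variables (R : realType) (k : nat).
Hypothesis k_gt0 : (0 < k)%N.

Let T := core_operator (@poly_submodule R ('X^k - ('X^k)%:P)).

Lemma csum_diag (f : coefs R) a b :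
  csum k f (k * a, k * b)%N = csum k f (0, k * (a + b))%N.
Proof.
by apply: csum_class; split; rewrite /= ?add0n -?mulnDr // modnMr mod0n.
Qed.

Lemma csum_expand (f : coefs R) n : csum k f (0, k * n.+1)%N =
  f (0, k * n.+1)%N + \sum_(i < n) f (k * i.+1, k * (n - i))%N
  + f (k * n.+1, 0)%N.
Proof.
rewrite -[X in (X, _)](muln0 k) csum_mult // add0n big_ord_recl big_ord_recr /=.
rewrite muln0 subn0 subnn muln0 addrA; congr (_ + _ + _).
Qed.

Lemma natf_neq0 n : n.+1%:R != 0 :> R[i].
Proof. by rewrite pnatr_eq0. Qed.

Section Eigenvector.
Variables (l : R[i]) (f : coefs R).
Hypotheses (l0 : l != 0) (fE : eigenspace_of T l f).

Lemma eig_csum0 n : csum k f (0, k * n.+1)%N = 0.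
Proof.
have [hf E] := fE.
set s := csum _ _ _.
have sE : s = _ := csum_expand f n.
set p := f (0, _)%N in sE; set q := f (_, 0)%N in sE.
have Ep : (s - q) / n.+1%:R - s / n.+2%:R = l * p.
  by rewrite -E /T core_operator_left.
have Eq : (s - p) / n.+1%:R - s / n.+2%:R = l * q.
  rewrite -E /T core_operator_bottom //.
  by have := csum_diag f n.+1 0; rewrite muln0 addn0 => ->.
have Ei : l * \sum_(i < n) f (k * i.+1, k * (n - i))%N =
    n%:R * ((s - p) / n.+1%:R + (s - q) / n.+1%:R - s / n.+2%:R
            - (s - p - q) / n%:R).
  (* By [core_operator_inner] the value depends only on the degree, so the n inner terms all equal
     x. *)
  set x := _ - _ / n%:R; rewrite mulr_sumr.
  rewrite (eq_bigr (fun=> x)) ?sumr_const ?card_ord ?mulr_natl // => i _.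
  rewrite -E /T.
  have [b bE] : exists b, (n - i = b.+1)%N.
    by exists (n - i).-1; rewrite prednK // subn_gt0.
  have inE : n = (i + b).+1 by have := ltn_ord i; lia.
  by rewrite bE core_operator_inner //= csum_diag addSn addnS /s /p /q -inE.
have : l * s = 0.
  apply: eig_degree_sum sE _ Ep Eq Ei => n0.
  by apply: big1 => i; have := ltn_ord i; rewrite {2}n0.
by move/eqP; rewrite mulf_eq0 (negPf l0) => /eqP.
Qed.

Lemma eig_left n : l * f (0, k * n.+1)%N = - f (k * n.+1, 0)%N / n.+1%:R.
Proof.
have [hf E] := fE.
by rewrite -E /T core_operator_left // eig_csum0 mul0r subr0 sub0r.
Qed.

Lemma eig_bottom n : l * f (k * n.+1, 0)%N = - f (0, k * n.+1)%N / n.+1%:R.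
Proof.
have [hf E] := fE; have := csum_diag f n.+1 0; rewrite muln0 addn0 => D.
by rewrite -E /T core_operator_bottom // D eig_csum0 mul0r subr0 sub0r.
Qed.

Lemma eig_inner a b : l * f (k * a.+1, k * b.+1)%N =
  (f (0, k * (a + b).+2)%N + f (k * (a + b).+2, 0)%N)
    / ((a + b).+2%:R * (a + b).+1%:R).
Proof.
have [hf E] := fE.
rewrite -E /T core_operator_inner //= csum_diag addSn addnS eig_csum0.
have h2 := natf_neq0 (a + b).+1; have h1 := natf_neq0 (a + b); field.
by rewrite -?natrD ?nat1r !pnatr_eq0.
Qed.

Lemma eig_off i j : ~~ ((k %| i) && (k %| j))%N -> f (i, j) = 0.
Proof.
move=> kij; have [hf E] := fE.
have /eqP := E (i, j); rewrite /T core_operator_off // eq_sym mulf_eq0 (negPf l0).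
by move/eqP.
Qed.

Lemma eig_origin : f (0, 0)%N = 0.
Proof.
have [hf E] := fE.
have /eqP := E (0, 0)%N; rewrite /T core_operator_origin // eq_sym mulf_eq0 (negPf l0).
by move/eqP.
Qed.

Lemma eig_sqr n : f (0, k * n.+1)%N != 0 -> (l * n.+1%:R) ^+ 2 = 1.
Proof.
move=> p0; apply: (mulIf p0).
have h := natf_neq0 n; have L := eig_left n; have B := eig_bottom n.
set p := f (0, _)%N in p0 L B *; set q := f (_, 0)%N in L B.
have qE : q = - (l * n.+1%:R * p).
  by rewrite mulrAC L divfK // opprK.
rewrite mul1r -[RHS]opprK -[- p](divfK h) -B qE; ring.
Qed.

Lemma eig_degree0 n a b : f (0, k * n.+1)%N = 0 -> (a + b = n.+1)%N ->
  f (k * a, k * b)%N = 0.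
Proof.
move=> p0 abn.
have q0 : f (k * n.+1, 0)%N = 0.
  have := eig_left n; rewrite p0 mulr0 => /esym/eqP.
  by rewrite mulf_eq0 invr_eq0 (negPf (natf_neq0 n)) orbF oppr_eq0 => /eqP.
case: a b abn => [|a] [|b] //= abn.
- by rewrite muln0 -abn in p0 *.
- by rewrite muln0; rewrite addn0 in abn; rewrite abn.
have nE : n = (a + b).+1 by lia.
apply/eqP; have /eqP := eig_inner a b.
by rewrite -nE p0 q0 addr0 mul0r mulf_eq0 (negPf l0).
Qed.

(** The second conclusion excludes -1: in degree k the zero class sum reads p + q = 0, and l p = - q
    becomes l p = p. *)
Lemma eigenvalue_form : (exists ij, f ij != 0) ->
  exists n, (l * n.+1%:R) ^+ 2 = 1 /\ (n = 0%N -> l = 1).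
Proof.
move=> [[i j] fij].
have /andP[/dvdnP [a ia] /dvdnP [b jb]] : ((k %| i) && (k %| j))%N.
  by apply: contraT => /eig_off fij0; rewrite fij0 eqxx in fij.
rewrite ia jb ![(_ * k)%N]mulnC in fij.
case abn: (a + b)%N => [|n].
  move/eqP: abn; rewrite addn_eq0 => /andP[/eqP a0 /eqP b0].
  by rewrite a0 b0 muln0 eig_origin eqxx in fij.
have p0 : f (0, k * n.+1)%N != 0.
  by apply: contra fij => /eqP p0; rewrite (eig_degree0 p0).
exists n; split; first exact: eig_sqr.
move=> n0; move: p0; rewrite n0 => p0; apply: (mulIf p0).
have := eig_csum0 0; rewrite csum_expand big_ord0 addr0 => /eqP.
by rewrite addr_eq0 mul1r eig_left divr1 => /eqP.
Qed.

End Eigenvector.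

(** * Explicit eigenvectors *)

(** The values forced by [eig_left] and [eig_inner] once the coefficient at (0, k n.+1) is 1. For l
    = 1 / n.+1 this is w^(k n.+1) - z^(k n.+1); for l = - 1 / n.+1 both end coefficients are 1 and
    the n inner ones are - 2 / n. For n = 0 no index is inner, so the division by n%:R is never
    reached. *)
Definition eigvec (n : nat) (l : R[i]) : coefs R := fun p =>
  if [&& p.1 + p.2 == k * n.+1, k %| p.1 & k %| p.2]%N then
    if p.1 == 0%N then 1 else if p.2 == 0%N then - (l * n.+1%:R)
    else (1 - l * n.+1%:R) / (l * n.+1%:R * n%:R)
  else 0.

Lemma eigvec_mult n l a b : eigvec n l (k * a, k * b)%N =
  if (a + b == n.+1)%N then
    if a == 0%N then 1 else if b == 0%N then - (l * n.+1%:R)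
    else (1 - l * n.+1%:R) / (l * n.+1%:R * n%:R)
  else 0.
Proof.
rewrite /eigvec /= !dvdn_mulr // !andbT -mulnDr eqn_pmul2l //.
by rewrite !muln_eq0 eqn0Ngt k_gt0.
Qed.

Lemma eigvec_span n l f : (l * n.+1%:R) ^+ 2 = 1 -> eigenspace_of T l f ->
  exists c, forall ij, f ij = c * eigvec n l ij.
Proof.
move=> ln fE; have h := natf_neq0 n.
have l0 : l != 0.
  by apply/eqP => l0; move/eqP: ln; rewrite l0 mul0r expr0n eq_sym oner_eq0.
exists (f (0, k * n.+1)%N) => -[i j].
have [/andP[/dvdnP [a ia] /dvdnP [b jb]]|kij] := boolP ((k %| i) && (k %| j))%N;
  last first.
  by rewrite (eig_off l0 fE) // /eigvec /= (negPf kij) andbF mulr0.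
rewrite ia jb ![(_ * k)%N]mulnC eigvec_mult.
have [abn|abn] := eqVneq (a + b)%N n.+1; last first.
  rewrite mulr0; case mE: (a + b)%N abn => [|m] abn.
    move/eqP: mE; rewrite addn_eq0 => /andP[/eqP -> /eqP ->].
    by rewrite muln0 (eig_origin l0 fE).
  apply: (eig_degree0 l0 fE _ mE); apply/eqP; apply: contraT => p0.
  (* A nonzero entry in degree k m.+1 would give (l m.+1)^2 = (l n.+1)^2, hence m = n. *)
  have := etrans (eig_sqr l0 fE p0) (esym ln).
  rewrite !exprMn => /(mulfI (expf_neq0 2 l0)) /eqP.
  by rewrite -!natrX eqr_nat eqn_exp2r // (negPf abn).
have L := eig_left l0 fE n.
have q : f (k * n.+1, 0)%N = f (0, k * n.+1)%N * - (l * n.+1%:R).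
  by rewrite mulrN mulrCA mulrA L divfK // opprK.
case: a b abn {ia jb} => [|a] [|b] abn //.
- by rewrite muln0 /= mulr1 -abn.
- by rewrite muln0 /=; rewrite addn0 in abn; rewrite abn.
have nE : n = (a + b).+1 by lia.
apply: (mulfI l0); rewrite (eig_inner l0 fE) -nE q /=.
have : n%:R != 0 :> R[i] by rewrite nE natf_neq0.
by move=> n0; field; rewrite l0 n0 -?natrD ?nat1r ?pnatr_eq0.
Qed.

(** With x = l n.+1 the class sum in degree k n.+1 is 1 + (1 - x) / x - x = (1 - x^2) / x. For n = 0
    the middle term is absent and 1 - l has to vanish, which is the second hypothesis. *)
Lemma csum_eigvec n l p : (l * n.+1%:R) ^+ 2 = 1 -> (n = 0%N -> l = 1) ->
  csum k (eigvec n l) p = 0.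
Proof.
move=> ln n1.
have l0 : l != 0.
  by apply/eqP => l0; move/eqP: ln; rewrite l0 mul0r expr0n eq_sym oner_eq0.
have [pn|pn] := eqVneq (p.1 + p.2)%N (k * n.+1)%N; last first.
  by apply: csum0 => q [qp _]; rewrite /eigvec qp (negPf pn).
have [kp|kp] := boolP (k %| p.1)%N; last first.
  apply: csum0 => q [_ qp]; rewrite /eigvec.
  have /negPf -> : ~~ (k %| q.1)%N by rewrite /dvdn qp.
  by rewrite andbF.
have -> : csum k (eigvec n l) p = csum k (eigvec n l) (0, k * n.+1)%N.
  by apply: csum_class; split; rewrite /= ?add0n // mod0n; apply/eqP.
rewrite csum_expand -{1 2}(muln0 k) !eigvec_mult add0n addn0 eqxx /=.
rewrite (eq_bigr (fun=> (1 - l * n.+1%:R) / (l * n.+1%:R * n%:R))); last first.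
  move=> i _; have ni := ltn_ord i; rewrite eigvec_mult (_ : _ == _); last by lia.
  by rewrite (_ : (n - i == 0)%N = false) //; lia.
rewrite sumr_const card_ord.
case: n ln n1 {pn kp} => [|n] ln n1; first by rewrite n1 //; ring.
have h := natf_neq0 n; have h2 := natf_neq0 n.+1.
rewrite [X in _ + X + _](_ : _ = (1 - l * n.+2%:R) / (l * n.+2%:R)); last first.
  by field; rewrite l0 -?natrD ?nat1r !pnatr_eq0.
have x0 := mulf_neq0 l0 h2; move: (l * n.+2%:R) => x in ln x0 *.
have -> : 1 + (1 - x) / x - x = (1 - x ^+ 2) / x by field.
by rewrite ln subrr mul0r.
Qed.

Lemma eigvec_eigen n l : (l * n.+1%:R) ^+ 2 = 1 -> (n = 0%N -> l = 1) ->
  eigenspace_of T l (eigvec n l).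
Proof.
move=> ln n1.
have l0 : l != 0.
  by apply/eqP => l0; move/eqP: ln; rewrite l0 mul0r expr0n eq_sym oner_eq0.
have he : hardy2 (eigvec n l).
  apply: (@hardy2_fin _ _ (k * n.+1).+1) => p pn; rewrite /eigvec.
  by rewrite gtn_eqF.
have s0 p := @csum_eigvec n l p ln n1.
split=> // -[i j].
have [/andP[/dvdnP [a ia] /dvdnP [b jb]]|kij] := boolP ((k %| i) && (k %| j))%N;
  last first.
  by rewrite /T core_operator_off // /eigvec /= (negPf kij) andbF mulr0.
rewrite ia jb ![(_ * k)%N]mulnC.
have left0 c : eigvec n l (0, k * c)%N = if c == n.+1 then 1 else 0.
  by rewrite -{1}(muln0 k) eigvec_mult.
have bottom0 c : eigvec n l (k * c, 0)%N = if c == n.+1 then - (l * n.+1%:R) else 0.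
  by rewrite -{1}(muln0 k) eigvec_mult addn0; case: eqP => // ->.
have h := natf_neq0 n.
case: a b {ia jb} => [|a] [|b].
- by rewrite !muln0 /T core_operator_origin // -{2}(muln0 k) left0 mulr0.
- rewrite muln0 /T core_operator_left // s0 bottom0 left0.
  case: eqVneq => [->|_]; last by ring.
  by field; rewrite -?natrD ?nat1r ?pnatr_eq0.
- rewrite muln0 /T core_operator_bottom // s0 bottom0 left0.
  case: eqVneq => [->|_]; last by ring.
  (* The left equation holds by the choice of the bottom value; the bottom one is exactly (l n.+1)^2
     = 1. *)
  apply: (mulIf h); rewrite mul0r subr0 sub0r divfK //.
  by transitivity (- (l * n.+1%:R) ^+ 2); [rewrite ln | ring].
rewrite /T core_operator_inner //= s0 left0 bottom0 eigvec_mult addSn addnS.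
case: eqVneq => [[nE]|_] /=; last by ring.
rewrite -nE; have h2 := natf_neq0 (a + b); have h3 := natf_neq0 (a + b).+1.
by field; rewrite l0 -?natrD ?nat1r !pnatr_eq0.
Qed.

Lemma has_multiplicity_eigvec n l :
  (l * n.+1%:R) ^+ 2 = 1 -> (n = 0%N -> l = 1) -> has_multiplicity T l 1.
Proof.
move=> ln n1; apply: (has_multiplicity1 (p := (0, k * n.+1)%N) (eigvec_eigen ln n1)).
  by rewrite /eigvec /= add0n eqxx dvdn0 dvdn_mulr // oner_eq0.
by move=> f; exact: eigvec_span.
Qed.

(** The monomials z w^s lie in the kernel: for k >= 2 the index 1 is not a multiple of k, so every
    class sum and end value in the formulas for C vanishes. *)
Lemma infinite_multiplicity0 : (1 < k)%N -> infinite_multiplicity T 0.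
Proof.
move=> k1 n; exists (fun s => delta R (1%N, s : nat)).
  move=> s; split=> [|[i j]]; first exact: hardy2_delta.
  have hd := hardy2_delta R (1%N, s : nat).
  have d0 a j' : delta R (1%N, s : nat) (k * a, j')%N = 0.
    rewrite /delta; case: eqP => // -[/eqP]; rewrite muln_eq1.
    by case: k k1 => [|[]].
  have s0 a b : csum k (delta R (1%N, s : nat)) (k * a, k * b)%N = 0.
    by rewrite csum_mult //; apply: big1 => c _; exact: d0.
  rewrite mul0r /T.
  have [/andP[/dvdnP [a ia] /dvdnP [b jb]]|kij] := boolP ((k %| i) && (k %| j))%N;
    last by rewrite core_operator_off.
  rewrite ia jb ![(_ * k)%N]mulnC.
  have d00 j' : delta R (1%N, s : nat) (0, j')%N = 0 by [].
  case: a b {ia jb} => [|a] [|b].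
  - by rewrite muln0 core_operator_origin.
  - by rewrite muln0 core_operator_left // -[X in (X, (k * b.+1)%N)](muln0 k) s0 d0; ring.
  - by rewrite muln0 core_operator_bottom // -[X in ((k * a.+1)%N, X)](muln0 k) s0 d00; ring.
  by rewrite core_operator_inner //= s0 d00 d0; ring.
move=> c c0 s; have := c0 (1%N, s : nat); rewrite (bigD1 s) //= big1 => [|t ts].
  by rewrite addr0 /delta eqxx mulr1.
rewrite /delta; case: eqP => [[]|_]; last by rewrite mulr0.
by move=> /val_inj st; rewrite st eqxx in ts.
Qed.

End Eigen.

Theorem corollary3p1 (R : realType) (k : nat) (hk : (2 <= k)%N) :
  let C := core_operator (@poly_submodule R ('X^k - ('X^k)%:P)) in
  [/\ [set l : R[i] | is_eigenvalue C l] =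
        [set 0; 1] `|`
        [set l | exists2 m : nat, (1 <= m)%N &
                   l = (m.+1%:R)^-1 \/ l = - (m.+1%:R)^-1],
      infinite_multiplicity C 0,
      has_multiplicity C 1 1
    & forall m : nat, (1 <= m)%N ->
        has_multiplicity C (m.+1%:R)^-1 1 /\
        has_multiplicity C (- (m.+1%:R)^-1) 1].
Proof.
have k_gt0 : (0 < k)%N by exact: ltnW.
move=> C.
have mult0 : infinite_multiplicity C 0 by exact: infinite_multiplicity0.
have mult1 : has_multiplicity C 1 1.
  by apply: (@has_multiplicity_eigvec R k k_gt0 0) => //; rewrite mul1r expr1n.
have multP m : (1 <= m)%N -> has_multiplicity C (m.+1%:R)^-1 1.
  move=> m1; apply: (@has_multiplicity_eigvec R k k_gt0 m).
    by rewrite mulVf ?expr1n // natf_neq0.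
  by move=> m0; rewrite m0 in m1.
have multN m : (1 <= m)%N -> has_multiplicity C (- (m.+1%:R)^-1) 1.
  move=> m1; apply: (@has_multiplicity_eigvec R k k_gt0 m).
    by rewrite mulNr mulVf ?sqrrN ?expr1n // natf_neq0.
  by move=> m0; rewrite m0 in m1.
split=> //; last by move=> m m1; split; [exact: multP|exact: multN].
apply/seteqP; split=> l /=; last first.
  case=> [[->|->]|[m m1 [->|->]]]; apply: is_eigenvalue_mult.
  - exact: mult0.
  - by case: mult1.
  - by case: (multP m m1).
  - by case: (multN m m1).
move=> [f fE fn0]; have [->|l0] := eqVneq l 0; first by left; left.
have [n [ln n1]] := eigenvalue_form k_gt0 l0 fE fn0.
(* Degree k yields l = 1; degree k n.+2 yields the pair with m = n.+1. *)
case: n ln n1 => [|n] ln n1; first by left; right; exact: n1.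
right; exists n.+1 => //.
move/eqP: ln; rewrite sqrf_eq1 => /orP[|] /eqP ln; [left|right].
  by rewrite -[LHS](mulfK (natf_neq0 R n.+1)) ln mul1r.
by rewrite -[LHS](mulfK (natf_neq0 R n.+1)) ln mulN1r.
Qed.
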